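(* Let $\mathbb{F}_q$ be a finite field and let $k,t,n$ be integers with $0\le t\le k$ and $(n-1)(k-t)\le k$. Let $\epsilon,\eta$ be integers with $0\le\epsilon\le k-t$ and $2\le\eta\le n-1$. Then there exist a vector space $\mathcal{V}$ over $\mathbb{F}_q$ and a $(k,k-t)$-SCID $\{\pi_1,\ldots,\pi_n\}$ in $\mathcal{V}$ with $n$ elements such that \[\dim S+\dim I=nk-(\eta-2)(k-t)-\epsilon,\] where $S:=\langle\pi_1,\ldots,\pi_n\rangle$ and $I:=\langle \pi_i\cap\pi_j\mid i\neq j\rangle$.
   Context: A $(k,k-t)$-SCID is a set of (distinct) $k$-dimensional subspaces of a vector space, containing at least two elements, such that any two distinct members intersect in a subspace of dimension exactly $k-t$. $\langle\cdot\rangle$ denotes the span. The dimension of the ambient vector space is not fixed in advance.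
   Formalization: The formal statement additionally assumes k ≥ 1; for k = 0 (so t = ε = 0) the claim as written fails, since there is only one 0-dimensional subspace and hence no SCID with n ≥ 3 distinct elements. *)

(* Defs.v *)
From mathcomp Require Export all_boot all_order all_algebra.

Set Implicit Arguments.
Unset Strict Implicit.
Unset Printing Implicit Defensive.

Import GRing.Theory.

(* A (k, m)-SCID: at least two elements, all of dimension k, with any two
   distinct ones meeting in dimension exactly m.  Distinctness of the members
   is built in, since A is a set and not a family. *)
Definition SCID (F : fieldType) (V : vectType F) (k m : nat)
    (A : {pred {vspace V}}) : Prop :=
  [/\ exists U W, [/\ U \in A, W \in A & U != W],
      forall U, U \in A -> \dim U = k
    & forall U W, U \in A -> W \in A -> U != W -> \dim (U :&: W)%VS = m].

Definition scid_span (F : fieldType) (V : vectType F) (n : nat)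
    (pi : 'I_n -> {vspace V}) : {vspace V} := (\sum_(i < n) pi i)%VS.

Definition scid_meet_span (F : fieldType) (V : vectType F) (n : nat)
    (pi : 'I_n -> {vspace V}) : {vspace V} :=
  (\sum_(i < n) \sum_(j < n | i != j) (pi i :&: pi j))%VS.

(* Main.v *)
Require Import Defs.
From mathcomp Require Import all_boot all_order all_algebra.
From mathcomp Require Import zify.

Set Implicit Arguments.
Unset Strict Implicit.
Unset Printing Implicit Defensive.

Import GRing.Theory.

Local Open Scope ring_scope.

(** All members are spanned by subsets [A i] of one basis, so that intersections
    and sums of members are read off the sets. A basis vector lying in [r]
    members contributes [r] to [nk] and [min r 2] to [dim S + dim I], so
    [nk - dim S - dim I] is the sum of the [max (r - 2) 0]. Let [m = k - t].
    Take [m] vectors, [eps] of which lie in the members [0, ..., eta] and the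
    others in the members [0, ..., eta - 1] only: they contribute
    [(eta - 2) m + eps]. Every pair of members is completed to an
    [m]-dimensional intersection by vectors lying in just these two members,
    and every member to dimension [k] by vectors of its own; neither changes the
    total, and there is room since [(n - 1) m <= k]. *)

(** * From finite sets to subspaces *)

Section CoordinateSubspace.
Variables (F : fieldType) (T : finType).

Definition basis_vector (x : T) : {ffun T -> F^o} := [ffun y => (x == y)%:R].

Definition coordinate_subspace (A : {set T}) : {vspace {ffun T -> F^o}} :=
  <<[seq basis_vector x | x <- enum A]>>%VS.

(** Vanishing conditions combine under intersection, which a description by spanning vectors does
    not show; [coordinate_subspaceI] rests on this. *)
Lemma memv_coordinate_subspace (A : {set T}) (v : {ffun T -> F^o}) :
  reflect (forall x, x \notin A -> v x = 0) (v \in coordinate_subspace A).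
Proof.
apply: (iffP idP) => [|vA].
  rewrite /coordinate_subspace span_def big_map big_enum.
  move=> /memv_sumP[u uA -> x xA].
  rewrite sum_ffunE big1 // => y yA; case/vlineP: (uA y yA) => c ->.
  rewrite !ffunE; case: eqP => [yx|_]; last by rewrite scaler0.
  by rewrite -yx yA in xA.
have -> : v = \sum_(x in A) v x *: basis_vector x.
  apply/ffunP => y; rewrite sum_ffunE.
  have [yA|yA] := boolP (y \in A).
    rewrite (bigD1 y) //= !ffunE eqxx big1 ?addr0.
      by rewrite /GRing.scale /= mulr1.
    by move=> x /andP[_ /negPf xy]; rewrite !ffunE xy scaler0.
  rewrite vA // big1 // => x xA; rewrite !ffunE; case: eqP => [xy|_].
    by rewrite -xy xA in yA.
  by rewrite scaler0.
apply: rpred_sum => x xA; apply/rpredZ/memv_span/map_f.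
by rewrite mem_enum.
Qed.

Lemma coordinate_subspace0 : coordinate_subspace set0 = 0%VS.
Proof. by rewrite /coordinate_subspace enum_set0 span_nil. Qed.

Lemma coordinate_subspaceU A B :
  coordinate_subspace (A :|: B) =
  (coordinate_subspace A + coordinate_subspace B)%VS.
Proof.
rewrite /coordinate_subspace -span_cat -map_cat; apply/eq_span/eq_mem_map => x.
by rewrite mem_cat !mem_enum in_setU.
Qed.

Lemma coordinate_subspaceI A B :
  coordinate_subspace (A :&: B) =
  (coordinate_subspace A :&: coordinate_subspace B)%VS.
Proof.
apply/vspaceP => v; rewrite memv_cap.
apply/memv_coordinate_subspace/andP => [vAB|[/memv_coordinate_subspace vA]].
  by split; apply/memv_coordinate_subspace => x xN; apply: vAB;
    rewrite in_setI negb_and xN ?orbT.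
move=> /memv_coordinate_subspace vB x.
by rewrite in_setI negb_and => /orP[/vA|/vB].
Qed.

Lemma dim_coordinate_subspace A : \dim (coordinate_subspace A) = #|A|.
Proof.
have -> : #|A| = size [seq basis_vector x | x <- enum A].
  by rewrite size_map cardE.
(* [free] is by definition the equality of the dimension of the span with the size. *)
apply/eqP; change (free (in_tuple [seq basis_vector x | x <- enum A])).
apply/freeP => c c0 i.
have ltiA : (i < size (enum A))%N by rewrite -(size_map basis_vector) ltn_ord.
(* A default for [nth]; [T] is inhabited because the index [i] makes [enum A] nonempty. *)
have x0 : T by move: (nat_of_ord i) ltiA => j; case: (enum A).
move/ffunP/(_ (nth x0 (enum A) i)): c0.
rewrite sum_ffunE (bigD1 i) //= big1 ?addr0.
  rewrite !ffunE (nth_map x0) // ffunE eqxx.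
  by rewrite /GRing.scale /= mulr1.
move=> j ji; rewrite !ffunE (nth_map x0); last first.
  by rewrite -(size_map basis_vector) ltn_ord.
rewrite ffunE nth_uniq ?enum_uniq //; last first.
  by rewrite -(size_map basis_vector) ltn_ord.
by rewrite [(j == i :> nat)](negPf ji) scaler0.
Qed.

End CoordinateSubspace.

(** * Double counting in families of finite sets *)

Local Open Scope nat_scope.

Definition degree (I T : finType) (A : I -> {set T}) (x : T) :=
  #|[set i | x \in A i]|.

Lemma card_set_sum (T : finType) (A : {set T}) : #|A| = \sum_x (x \in A).
Proof. by rewrite -sum1_card big_mkcond; apply: eq_bigr => x _; case: ifP. Qed.

(** Count element by element: for [r = degree A x] the identity is
    [r = (0 < r) + (1 < r) + (r - 2)], with truncated subtraction. *)
Lemma sum_card_cover (I T : finType) (A : I -> {set T}) :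
  \sum_i #|A i| =
  #|\bigcup_i A i| + #|\bigcup_i \bigcup_(j | i != j) (A i :&: A j)|
    + \sum_x (degree A x - 2).
Proof.
rewrite !card_set_sum -!big_split (eq_bigr _ (fun i _ => card_set_sum (A i))).
rewrite exchange_big; apply: eq_bigr => x _ /=.
have -> : \sum_i (x \in A i) = degree A x.
  by rewrite /degree card_set_sum; apply: eq_bigr => i _; rewrite inE.
have -> : (x \in \bigcup_i A i) = (0 < degree A x).
  apply/bigcupP/card_gt0P => [[i _ xi]|[i]]; first by exists i; rewrite inE.
  by rewrite inE => xi; exists i.
have -> : (x \in \bigcup_i \bigcup_(j | i != j) (A i :&: A j)) = (1 < degree A x).
  apply/bigcupP/card_gt1P => [[i _ /bigcupP[j ij]]|[i [j []]]].
    by rewrite inE => /andP[xi xj]; exists i, j; rewrite !inE.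
  rewrite !inE => xi xj ij; exists i => //; apply/bigcupP; exists j => //.
  by rewrite inE xi.
by lia.
Qed.

(** * Construction of the sets *)

Lemma sum_ord_lt n a : a <= n -> \sum_(y < n) (y < a) = a.
Proof.
move=> lean; rewrite -[RHS]card_ord -sum1_card (big_ord_widen n (fun=> 1)) //.
by rewrite [RHS]big_mkcond; apply: eq_bigr => y _; case: ifP.
Qed.

Lemma card_set_sumType (T1 T2 : finType) (A : {set T1 + T2}) :
  #|A| = \sum_x (inl x \in A) + \sum_y (inr y \in A).
Proof. by rewrite card_set_sum big_sumType. Qed.

(** The private elements of [B i] are the [inr (i, y)] with [y < k - #|B i|]. Their degree is at
    most 1, so they enter no intersection and add nothing to the truncated sum. *)
Lemma pad_sets (I U : finType) (k : nat) (B : I -> {set U}) :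
  (forall i, #|B i| <= k) ->
  exists (T : finType) (A : I -> {set T}),
    [/\ forall i, #|A i| = k,
        forall i j, i != j -> #|A i :&: A j| = #|B i :&: B j|
      & \sum_x (degree A x - 2) = \sum_x (degree B x - 2)].
Proof.
move=> Bk; pose T : finType := (U + I * 'I_k)%type.
pose A i : {set T} := [set e : T | match e with
  | inl u => u \in B i | inr (j, y) => (j == i) && (y < k - #|B i|) end].
exists T, A; split=> [i|i j ij|].
- rewrite card_set_sumType.
  under eq_bigr do rewrite inE.
  rewrite -card_set_sum [X in _ + X](eq_bigr
    (fun p => inr (p.1, p.2) \in A i : nat)); last by case.
  rewrite -(pair_bigA _ (fun j y => inr (j, y) \in A i : nat)) /=.
  rewrite (bigD1 i) //= [X in _ + (_ + X)]big1 => [|j /negPf ji]; last first.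
    by rewrite big1 // => y _; rewrite inE ji.
  under eq_bigr do rewrite inE eqxx /=.
  by rewrite sum_ord_lt ?leq_subr // addn0 subnKC.
- rewrite card_set_sumType.
  under eq_bigr do rewrite !inE -in_setI.
  rewrite -card_set_sum big1 ?addn0 // => -[h y] _; rewrite !inE.
  by case: eqP => //= ->; rewrite (negPf ij) andbF.
- rewrite big_sumType /= [X in _ + X]big1 ?addn0 => [|[h y] _].
    by apply: eq_bigr => u _; congr (_ - _); apply: eq_card => i; rewrite !inE.
  apply/eqP; rewrite subn_eq0; apply: leq_trans (_ : 1 <= 2) => //.
  rewrite -(cards1 h); apply/subset_leq_card/subsetP => i.
  by rewrite !inE => /andP[/eqP->].
Qed.

(* [inl x] is the [x]-th shared element; [inr (i, j, x)] with [i < j] stands in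
   for it in the intersection of [B i] and [B j] when [x] is not shared by both. *)
Lemma constant_intersection_sets (n m eps eta : nat) :
  eps <= m -> 1 < eta < n ->
  exists (U : finType) (B : 'I_n -> {set U}),
    [/\ forall i j, i != j -> #|B i :&: B j| = m,
        forall i u, u \in B i -> exists2 j, i != j & u \in B j
      & \sum_x (degree B x - 2) = (eta - 2) * m + eps].
Proof.
move=> lem /andP[eta1 etan].
pose sh (x : 'I_m) (i : 'I_n) := i < eta + (x < eps).
pose U : finType := ('I_m + 'I_n * 'I_n * 'I_m)%type.
pose B i : {set U} := [set e : U | match e with
  | inl x => sh x i
  | inr (a, b, x) => [&& a < b, ~~ (sh x a && sh x b) & (i == a) || (i == b)]
  end].
have BI (i j : 'I_n) : i < j -> #|B i :&: B j| = m.
  move=> ltij; rewrite card_set_sumType.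
  under eq_bigr do rewrite !inE.
  rewrite [X in _ + X](eq_bigr
    (fun p => inr (p.1, p.2) \in B i :&: B j : nat)); last by case.
  rewrite -(pair_bigA _ (fun p x => inr (p, x) \in B i :&: B j : nat)) /=.
  rewrite (bigD1 (i, j)) //= [X in _ + (_ + X)]big1 => [|[a b] abij]; last first.
    rewrite big1 // => x _; rewrite !inE; apply/eqP; rewrite eqb0.
    apply: contra abij => /andP[/and3P[ltab _ ei] /and3P[_ _ ej]].
    rewrite xpair_eqE -!val_eqE /= in ei ej *; lia.
  (* For each [x], exactly one of [inl x] and [inr (i, j, x)] lies in both sets. *)
  rewrite addn0 -big_split /= -[RHS]card_ord -sum1_card.
  apply: eq_bigr => x _; rewrite !inE !eqxx ltij orbT /= !andbT andbb.
  by case: (_ && _).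
exists U, B; split=> [i j|i [x|[[a b] x]]|].
- rewrite -val_eqE neq_ltn => /orP[/BI //|/BI].
  by rewrite setIC.
- rewrite inE /sh => xi.
  (* As [eta >= 2], a shared element lies in both members 0 and 1, one of which differs from [i]. *)
  have n0 : 0 < n by lia.
  have n1 : 1 < n by lia.
  have [i0|i0] := eqVneq i (Ordinal n0).
    by exists (Ordinal n1); rewrite ?i0 ?inE // /sh /=; lia.
  by exists (Ordinal n0); rewrite ?inE // /sh /=; lia.
- rewrite inE => /and3P[ab nsh /orP[]/eqP->].
    exists b; first by rewrite -val_eqE /=; lia.
    by rewrite inE ab nsh eqxx orbT.
  exists a; first by rewrite -val_eqE /=; lia.
  by rewrite inE ab nsh eqxx.
rewrite big_sumType /= [X in _ + X]big1 ?addn0 => [|[[a b] x] _]; last first.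
  apply/eqP; rewrite subn_eq0 /degree; apply: leq_trans (_ : #|[set a; b]| <= 2).
    apply/subset_leq_card/subsetP => i.
    by rewrite !inE => /and3P[].
  by rewrite cards2; case: (_ == _).
have -> : (eta - 2) * m + eps = \sum_(x < m) (eta - 2 + (x < eps)).
  by rewrite big_split /= sum_nat_const card_ord sum_ord_lt // mulnC.
apply: eq_bigr => x _.
have -> : degree B (inl x) = eta + (x < eps).
  (* The bound [eta + (x < eps) <= n] is where [eta < n] is needed. *)
  rewrite -[RHS](@sum_ord_lt n); last by lia.
  by rewrite /degree card_set_sum; apply: eq_bigr => i _; rewrite !inE.
by lia.
Qed.

(** By the covering hypothesis, [B i] is the union of its intersections with the [#|I| - 1] other
    members. This bound gives the room for padding to size [k]. *)
Lemma card_le_sum_intersections (I U : finType) (m : nat) (B : I -> {set U}) :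
  (forall i j, i != j -> #|B i :&: B j| = m) ->
  (forall i u, u \in B i -> exists2 j, i != j & u \in B j) ->
  forall i, #|B i| <= (#|I| - 1) * m.
Proof.
move=> BI Bcov i.
have sub : B i \subset \bigcup_(j | i != j) (B i :&: B j).
  apply/subsetP => u ui; have [j ij uj] := Bcov _ _ ui.
  by apply/bigcupP; exists j; rewrite // inE ui.
apply: leq_trans (subset_leq_card sub) _.
apply: leq_trans (_ : \sum_(j | i != j) m <= _).
  elim/big_rec2: _ => [|j s A ij le]; first by rewrite cards0.
  by rewrite (leq_trans (leq_card_setU _ _)) // BI // leq_add2l.
rewrite sum_nat_const leq_mul2r; apply/orP; right.
have -> : #|[pred j | i != j]| = #|predC1 i|.
  by apply: eq_card => j; rewrite !inE eq_sym.
by rewrite cardC1 subn1.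
Qed.

Local Open Scope ring_scope.

Theorem theorem6 (F : finFieldType) (k t n eps eta : nat)
    (hk : (0 < k)%N)
    (htk : (t <= k)%N)
    (hn : ((n - 1) * (k - t) <= k)%N)
    (heps : (eps <= k - t)%N)
    (heta : (2 <= eta <= n - 1)%N) :
  exists (V : vectType F) (pi : 'I_n -> {vspace V}),
    [/\ injective pi,
        SCID k (k - t)%N [in codom pi]
      & (\dim (scid_span pi))%:Z + (\dim (scid_meet_span pi))%:Z
          = n%:Z * k%:Z - (eta%:Z - 2) * (k%:Z - t%:Z) - eps%:Z].
Proof.
(* Here [n >= 3], so [2 * (k - t) <= k] with [k > 0]. Strictness makes the members distinct. *)
have ltmk : (k - t < k)%N by nia.
have eta1n : (1 < eta < n)%N by lia.
have [U [B [BI Bcov Bdeg]]] := constant_intersection_sets heps eta1n.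
have Bk i : (#|B i| <= k)%N.
  apply: leq_trans (card_le_sum_intersections BI Bcov i) _.
  by rewrite card_ord.
have [T [A [Ak AI Adeg]]] := pad_sets Bk.
pose pi i := coordinate_subspace F (A i).
have piI i j : i != j -> \dim (pi i :&: pi j) = (k - t)%N.
  by move=> ij; rewrite -coordinate_subspaceI dim_coordinate_subspace AI ?BI.
have pik i : \dim (pi i) = k by rewrite dim_coordinate_subspace.
have pi_inj : injective pi.
  move=> i j pij; apply/eqP/negPn/negP => /piI.
  by rewrite pij capvv pik => km; rewrite -km ltnn in ltmk.
exists {ffun T -> F^o}, pi; split=> //.
  split=> [|W /codomP[i ->]|W1 W2 /codomP[i ->] /codomP[j ->] ij] //.
    have n0 : (0 < n)%N by lia.
    have n1 : (1 < n)%N by lia.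
    exists (pi (Ordinal n0)), (pi (Ordinal n1)).
    by split; rewrite ?codom_f // (inj_eq pi_inj).
  by apply: piI; apply: contra ij => /eqP->.
have morph := big_morph _ (@coordinate_subspaceU F T) (coordinate_subspace0 F T).
have -> : scid_span pi = coordinate_subspace F (\bigcup_i A i) by rewrite morph.
have -> : scid_meet_span pi =
    coordinate_subspace F (\bigcup_i \bigcup_(j | i != j) (A i :&: A j)).
  rewrite morph; apply: eq_bigr => i _; rewrite morph.
  by apply: eq_bigr => j _; rewrite coordinate_subspaceI.
rewrite !dim_coordinate_subspace.
have := sum_card_cover A; rewrite Adeg Bdeg.
rewrite (eq_bigr (fun=> k)) // sum_nat_const card_ord.
(* The natural subtractions agree with the integer ones since [t <= k] and [2 <= eta]. *)
by nia.
Qed.
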